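(* Let $G=C(7)\rtimes C(3)$ be the non-abelian group of order $21$, with conjugacy classes numbered $1$ (trivial class), $2=7A$, $3=7B$, $4=3A$, $5=3B$. Consider the class functions $u:G\to\mathbb C$ with $u(1)=u(2)=u(3)=1$ (these conditions are stable under $h\mapsto\wedge h-1$). Within this set, the condition $\overline{u(4)}=u(5)$ is invariant under $h\mapsto\wedge h-1$, and in terms of the real variables $(x,y)$ with $u(4)=x+iy$, the transformation $h\mapsto\wedge h-1$ is given by $$\Phi(x,y):=\left(2^{\frac13(2x+1)}\cos\left(\frac{2\pi y}{3\sqrt3}\right)-1,\ 2^{\frac13(2x+1)}\sin\left(\frac{2\pi y}{3\sqrt3}\right)\right).$$
   Context: $C(n)$ is the cyclic group of order $n$; $C(3)$ acts non-trivially on $C(7)$. $G$ has five conjugacy classes: the trivial class, two classes $7A,7B$ of elements of order $7$ (size $3$ each, interchanged by $g\mapsto g^{-1}$), and two classes $3A,3B$ of elements of order $3$ (size $7$ each, interchanged by $g\mapsto g^{-1}$). For a class function $u$, $u(i)$ denotes its value on the $i$-th class. For a finite group $G$ of odd order $k$, the wedge operation on complex valued class functions $f$ on $G$ is defined by $$\wedge(f)(g)=\exp\Big(\sum_{j=1}^k c_j f(g^j)\Big),\quad c_j=(-1)^{j+1}\frac{H(j/k)}{k},\quad H(u)=\sum_{m=0}^\infty\frac{(-1)^m}{m+u}\ (u>0),$$ and $\wedge f-1$ is the class function $g\mapsto\wedge(f)(g)-1$. Here $k=21$. *)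

(* Defs.v *)
From HB Require Import structures.
From mathcomp Require Import all_boot all_order all_algebra all_fingroup all_solvable.
From mathcomp Require Import all_classical all_reals all_analysis.
From mathcomp Require Import complex.
Set Implicit Arguments.
Unset Strict Implicit.
Unset Printing Implicit Defensive.
Import Order.TTheory GRing.Theory Num.Theory.
Import numFieldNormedType.Exports.
Local Open Scope ring_scope.

(* H(u) = \sum_(m >= 0) (-1)^m / (m + u); the series converges
   (conditionally) for every u > 0, the only case in which it is used. *)
Definition Hfun (R : realType) (u : R) : R :=
  limn (series (fun m : nat => (-1) ^+ m / (m%:R + u))).

Definition wedge_coef (R : realType) (k j : nat) : R :=
  (-1) ^+ j.+1 * (Hfun (j%:R / k%:R) / k%:R).

Definition cexp (R : realType) (z : R[i]) : R[i] := (
  let: x +i* y := z in (expR x * cos y) +i* (expR x * sin y))%C.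

Definition is_class_fun (R : realType) (gT : finGroupType) (f : gT -> R[i]) :
    Prop :=
  forall x y : gT, f (x ^ y)%g = f x.

(* Meaningful for groups of odd order only. *)
Definition wedge (R : realType) (gT : finGroupType) (f : gT -> R[i]) :
    gT -> R[i] :=
  fun g => let k := #|[set: gT]%SET| in
    cexp (\sum_(1 <= j < k.+1) (wedge_coef R k j)%:C%C * f (g ^+ j)%g).

Definition wedge_sub1 (R : realType) (gT : finGroupType) (f : gT -> R[i]) :
    gT -> R[i] :=
  fun g => wedge f g - 1.

Definition is_C7_sdprod_C3 (gT : finGroupType) : Prop :=
  exists K H : {group gT},
    [/\ K ><| H = [set: gT]%SET, cyclic K /\ #|K| = 7%N,
        cyclic H /\ #|H| = 3%N & ~~ abelian [set: gT]%SET]%g.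

Definition is_class_of_order (gT : finGroupType) (n : nat) (C : {set gT}) :
    Prop :=
  C \in classes [set: gT]%SET /\ {in C, forall g, #[g]%g = n}.

(* There are exactly two classes of elements of order 7 and two of elements
   of order 3, so being distinct suffices to make 7A, 7B (resp. 3A, 3B) all
   of them; which one is called A is arbitrary. *)
Record class_numbering (gT : finGroupType) : Type := ClassNumbering {
  C7A : {set gT};
  C7B : {set gT};
  C3A : {set gT};
  C3B : {set gT};
  C7A_order : is_class_of_order 7 C7A;
  C7B_order : is_class_of_order 7 C7B;
  C3A_order : is_class_of_order 3 C3A;
  C3B_order : is_class_of_order 3 C3B;
  C7A_neq_C7B : C7A <> C7B;
  C3A_neq_C3B : C3A <> C3B
}.

(* The value of a class function on a class, read off at any element of it. *)
Definition class_val (R : realType) (gT : finGroupType) (u : gT -> R[i])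
    (C : {set gT}) : R[i] :=
  u (repr C).

Definition one_off_3 (R : realType) (gT : finGroupType)
    (cl : class_numbering gT) : set (gT -> R[i]) :=
  [set u | is_class_fun u /\
    [/\ class_val u [set 1%g]%SET = 1, class_val u (C7A cl) = 1
      & class_val u (C7B cl) = 1]]%classic.

Definition conj_on_3 (R : realType) (gT : finGroupType)
    (cl : class_numbering gT) : set (gT -> R[i]) :=
  [set u | ((class_val u (C3A cl))^*)%C = class_val u (C3B cl)]%classic.

Definition coord_3A (R : realType) (gT : finGroupType)
    (cl : class_numbering gT) (u : gT -> R[i]) : R * R :=
  (complex.Re (class_val u (C3A cl)), complex.Im (class_val u (C3A cl))).

Definition Phi (R : realType) (p : R * R) : R * R :=
  let: (x, y) := p in
  (2 `^ (3^-1 * (2 * x + 1)) * cos (2 * pi * y / (3 * Num.sqrt 3)) - 1,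
   2 `^ (3^-1 * (2 * x + 1)) * sin (2 * pi * y / (3 * Num.sqrt 3))).

(* Main.v *)
(* Since k is odd, c_j is the sum of (-1)^(n+1)/n over the n >= 1 congruent to
   j mod k, so the exponent defining the wedge of f at g is
   sum_n (-1)^(n+1) f(g^n)/n. At an element g of order 3 with f(1) = 1,
   f(g) = x + iy and f(g^-1) = x - iy this is
   (ln 2)/3 + (2x/3) ln 2 + iy (1 + 1/2 - 1/4 - 1/5 + 1/7 + 1/8 - ...),
   and the last series is the integral of 1/(1 - t + t^2) over [0, 1], which is
   2 pi/(3 sqrt 3). Both this series and ln 2 are obtained without integration:
   the primitive minus the N-th partial sum of its power series has a
   derivative O(t^N) on [0, 1], hence varies by O(1/N). *)
Require Import Defs.
From mathcomp Require Import all_boot all_order all_algebra all_fingroup all_solvable.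
From mathcomp Require Import all_classical all_reals all_analysis.
From mathcomp Require Import complex.
From mathcomp Require Import ring lra.
Set Implicit Arguments.
Unset Strict Implicit.
Unset Printing Implicit Defensive.
Import Order.TTheory GRing.Theory Num.Theory.
Import numFieldNormedType.Exports.
Local Open Scope ring_scope.
Local Open Scope classical_set_scope.

(** * Alternating series and the coefficients of the wedge exponent *)

Section AlternatingSeries.
Context {R : realType}.
Implicit Types (u : R ^nat) (x : R).

(* Peeling off the first term sends a tail of the series to minus the next
   one, so all partial sums starting at [n] stay between [0] and [u n]. *)
Lemma alternating_sum_bound u n m :
  {homo u : i j / (i <= j)%N >-> j <= i} -> (forall i, 0 <= u i) ->
  `|\sum_(n <= i < m) (-1) ^+ i * u i| <= u n.
Proof.
move=> u_dec u_ge0.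
have [mn|/ltnW nm] := leqP m n; first by rewrite big_geq ?normr0.
rewrite -(subnK nm) -{1}[n]add0n big_addn addnK.
suff H k p : 0 <= \sum_(0 <= i < k) (-1) ^+ i * u (p + i)%N <= u p.
  under eq_bigr do rewrite addnC exprD -mulrA.
  rewrite -mulr_sumr normrM normrX normrN1 expr1n mul1r.
  by have /andP[/ger0_norm->] := H (m - n)%N n.
elim: k p => [|k IHk] p; first by rewrite big_nil lexx u_ge0.
rewrite big_nat_recl// addn0 expr0 mul1r.
have /andP[ge0 le_u] := IHk p.+1.
have -> : \sum_(0 <= i < k) (-1) ^+ i.+1 * u (p + i.+1)%N =
   - \sum_(0 <= i < k) (-1) ^+ i * u (p.+1 + i)%N :> R.
  rewrite -sumrN; apply: eq_bigr => i _.
  by rewrite exprS mulN1r mulNr addSnnS.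
by rewrite subr_ge0 (le_trans le_u) ?u_dec// gerBl.
Qed.

Lemma alternating_series_cvg u :
  {homo u : i j / (i <= j)%N >-> j <= i} -> (forall i, 0 <= u i) ->
  u @ \oo --> (0 : R) -> cvgn (series (fun i => (-1) ^+ i * u i)).
Proof.
move=> u_dec u_ge0 u_0; apply/cauchy_cvgP/cauchy_seriesP => e e0.
near=> n; apply: (le_lt_trans (alternating_sum_bound _ _ u_dec u_ge0)).
rewrite -[ltLHS]ger0_norm//; near: n.
have /cvgr0Pnorm_lt/(_ e e0) [N _ Ne] := u_0.
(* The Cauchy filter runs over pairs of indices, but the bound involves only the first one. *)
exists ([set n | (N <= n)%N], setT) => /=.
  by split; [exists N | exact: filterT].
by move=> [i j] /= [Ni _]; exact: Ne.
Unshelve. all: by end_near. Qed.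

(** [Hfun] is a [limn], which carries information only once the series is known to converge. *)
Lemma Hfun_series_cvg x : 0 < x ->
  series (fun m : nat => (-1) ^+ m / (m%:R + x)) @ \oo --> Hfun x.
Proof.
move=> x0; apply: (@alternating_series_cvg (fun m => (m%:R + x)^-1)).
- by move=> i j ij; rewrite lef_pV2 ?posrE ?ltr_wpDl// lerD2r ler_nat.
- by move=> i; rewrite invr_ge0 addr_ge0// ltW.
apply/gtr0_cvgV0; first by near=> i; rewrite ltr_wpDl.
apply/cvgryPge => M; near=> i.
rewrite (le_trans (y := i%:R)) ?lerDl ?(ltW x0)//; near: i.
exact: nbhs_infty_ger.
Unshelve. all: by end_near. Qed.

(** Sorting the terms of the alternating series by residue modulo [k] turns its partial sum of
    length [M * k] into a combination of the [M]-th partial sums of the [k] series [H(j/k)]. Only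
    lengths divisible by [k] occur, so convergence of [\sum (-1)^i a(i+1)/(i+1)] is required along
    these alone. *)
Lemma sum_wedge_coef (k : nat) (a : R ^nat) (l : R) : odd k ->
  (forall m j, a (m * k + j)%N = a j) ->
  (fun M => \sum_(0 <= i < M * k) (-1) ^+ i * a i.+1 / i.+1%:R) @ \oo --> l ->
  \sum_(1 <= j < k.+1) wedge_coef R k j * a j = l.
Proof.
move=> k_odd a_per a_l; have k0 : (0 < k)%N by case: k k_odd {a_per a_l}.
pose s M := \sum_(0 <= j < k) (-1) ^+ j.+2 *
  (series (fun m : nat => (-1) ^+ m / (m%:R + j.+1%:R / k%:R)) M / k%:R) * a j.+1.
have s_lim : s M @[M --> \oo] --> \sum_(0 <= j < k) wedge_coef R k j.+1 * a j.+1.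
  apply: cvg_big; first exact: add_continuous.
  move=> j _; apply: cvgMl; apply: cvgMr; apply: cvgMl.
  by apply: Hfun_series_cvg; rewrite divr_gt0 ?ltr0n.
have sE : s = fun M => \sum_(0 <= i < M * k) (-1) ^+ i * a i.+1 / i.+1%:R.
  apply/funext; elim=> [|M IHM].
    rewrite big_nil /s big1// => j _.
    by rewrite /series/= big_nil mul0r mulr0 mul0r.
  rewrite mulSnr (big_cat_nat _ (leq_addr k _))//= -IHM -{1}[(M * k)%N]add0n.
  rewrite big_addn addKn -big_split/=; apply: eq_big_nat => j /andP[_ jk].
  rewrite /series/= big_nat_recr//= !(mulrDr, mulrDl); congr (_ + _).
  have -> : a (j + M * k).+1 = a j.+1 by rewrite -addSn addnC a_per.
  (* As [k] is odd, [(-1)^(M k) = (-1)^M], which is the sign carried by the series for [H]. *)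
  rewrite exprD -[X in _ = _ * X * _ / _]signr_odd.
  rewrite oddM k_odd andbT signr_odd -addSn natrD natrM !exprS.
  have kR : k%:R != 0 :> R by rewrite pnatr_eq0 -lt0n.
  have jM : j.+1%:R + M%:R * k%:R != 0 :> R.
    by rewrite -natrM -natrD pnatr_eq0.
  by field; rewrite kR nat1r jM.
rewrite big_add1/= -(cvg_lim _ s_lim)// sE.
exact: cvg_lim.
Qed.

End AlternatingSeries.

(** * Comparing functions on [[0, 1]] through their derivatives *)

Section DerivativeComparison.
Context {R : realType}.

Lemma is_derive_monomial (n : nat) (x : R) :
  is_derive x 1 (fun y : R => y ^+ n.+1 / n.+1%:R) (x ^+ n).
Proof.
have := is_deriveZ n.+1%:R^-1 (is_deriveX n.+1 (is_derive_id x (1 : R))).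
congr is_derive; first by apply/funext => y; rewrite !fctE [LHS]mulrC.
by rewrite /GRing.scale/= mulr1 mulKf// pnatr_eq0.
Qed.

(** For each sign [s], the function [C x^(N+1)/(N+1) - s f(x)] has a nonnegative derivative on
    [[0, 1]]; comparing its values at 0 and 1 bounds [s (f 1 - f 0)]. *)
Lemma derive_bound_pow (f f' : R -> R) (C : R) (N : nat) :
  (forall x : R, 0 <= x <= 1 -> is_derive x 1 f (f' x)) ->
  (forall x : R, 0 <= x <= 1 -> `|f' x| <= C * x ^+ N) ->
  `|f 1 - f 0| <= C / N.+1%:R.
Proof.
move=> df f'_le.
have H (s : R) : `|s| = 1 -> s * (f 1 - f 0) <= C / N.+1%:R.
  move=> s1.
  pose g (x : R) : R := C * (x ^+ N.+1 / N.+1%:R) - s * f x.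
  have dg (x : R) : 0 <= x <= 1 -> is_derive x 1 g (C * x ^+ N - s * f' x).
    move=> x01.
    have := is_deriveB (is_deriveZ C (is_derive_monomial N x))
      (is_deriveZ s (df x x01)).
    by congr is_derive; apply/funext => y; rewrite /g !fctE.
  have g01 : g 0 <= g 1.
    apply: (@ger0_derive1_ndecr _ g 0 1) => // [x|x|].
    - rewrite in_itv/= => /andP[/ltW x0 /ltW x1].
      by apply: ex_derive; apply: dg; rewrite x0.
    - rewrite in_itv/= => /andP[/ltW x0 /ltW x1].
      have x01 : 0 <= x <= 1 by rewrite x0.
      rewrite derive1E (@derive_val _ _ _ _ _ _ _ (dg x x01)) subr_ge0.
      by rewrite (le_trans (ler_norm _))// normrM s1 mul1r f'_le.
    - apply: derivable_within_continuous => x; rewrite in_itv/= => x01.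
      by apply: ex_derive; exact: dg.
  move: g01; rewrite /g expr0n/= expr1n mul0r mulr0 mul1r mulrBr sub0r.
  by rewrite lerBrDr addrC.
rewrite ler_norml; apply/andP; split.
  by rewrite lerNl -mulN1r H ?normrN1.
by rewrite -[leLHS]mul1r H ?normr1.
Qed.

Lemma cvg_derive_bound_pow (P P' : nat -> R -> R) (F F' : R -> R) (C : R) :
  (forall N (x : R), 0 <= x <= 1 -> is_derive x 1 (P N) (P' N x)) ->
  (forall x : R, 0 <= x <= 1 -> is_derive x 1 F (F' x)) ->
  (forall N x, 0 <= x <= 1 -> `|P' N x - F' x| <= C * x ^+ N) ->
  P N 1 - P N 0 @[N --> \oo] --> F 1 - F 0.
Proof.
move=> dP dF le_C.
have dist N : `|(F 1 - F 0) - (P N 1 - P N 0)| <= C / N.+1%:R.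
  have dPF (x : R) : 0 <= x <= 1 -> is_derive x 1 (P N - F) (P' N x - F' x).
    by move=> x01; exact: is_deriveB (dP N x x01) (dF x x01).
  have -> : F 1 - F 0 - (P N 1 - P N 0) = - ((P N - F) 1 - (P N - F) 0).
    by rewrite !fctE; ring.
  by rewrite normrN; exact: derive_bound_pow dPF (le_C N).
apply/cvgrPdist_le => e e0.
have : C * harmonic N @[N --> \oo] --> C * 0 by apply: cvgMr; exact: cvg_harmonic.
rewrite mulr0 => /cvgr0Pnorm_le/(_ e e0); apply: filterS => N.
by apply: le_trans; rewrite (le_trans (dist N)) ?ler_norm.
Qed.

End DerivativeComparison.

(** * Closed forms of the series and of the weighted coefficient sums *)

Section SpecialSums.
Context {R : realType}.

Lemma geometric_sub_limit (y : R) (N : nat) : 1 + y != 0 ->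
  \sum_(i < N) (- y) ^+ i - (1 + y)^-1 = - ((- y) ^+ N / (1 + y)).
Proof.
move=> y1; have := subrX1 (- y) N.
have -> : - y - 1 = - (1 + y) by ring.
move=> /(canRL (subrK _)) ->; rewrite mulNr; field.
exact: y1.
Qed.

(** The polynomials [P N] are the Taylor sums of [ln (1 + x)], and their derivatives are geometric
    sums that differ from [1/(1 + x)] by at most [x^N]. *)
Lemma alternating_harmonic_cvg :
  \sum_(0 <= i < N) (-1) ^+ i / i.+1%:R @[N --> \oo] --> (ln 2 : R).
Proof.
pose P (N : nat) : R -> R :=
  \sum_(i < N) ((-1) ^+ i : R) \*: (fun x : R => x ^+ i.+1 / i.+1%:R).
pose P' (N : nat) (x : R) : R := \sum_(i < N) (- x) ^+ i.
have dP N (x : R) : 0 <= x <= 1 -> is_derive x 1 (P N) (P' N x).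
  move=> _; rewrite /P' (eq_bigr (fun i : 'I_N => (-1) ^+ i *: x ^+ i)).
    by apply: is_derive_sum => i; apply/is_deriveZ/is_derive_monomial.
  by move=> i _; rewrite /GRing.scale/= -exprNn.
have dF (x : R) : 0 <= x <= 1 ->
    is_derive x 1 (fun x : R => ln (1 + x)) (1 + x)^-1.
  move=> /andP[x0 _]; have x1 : 0 < 1 + x by rewrite ltr_pwDl.
  have d1 := is_deriveD (is_derive_cst (1 : R) x (1 : R)) (is_derive_id x (1 : R)).
  have := is_derive1_comp (is_derive1_ln x1) d1.
  by congr is_derive; rewrite add0r mulr1.
have le1 N (x : R) : 0 <= x <= 1 -> `|P' N x - (1 + x)^-1| <= 1 * x ^+ N.
  move=> /andP[x0 _]; have x1 : 0 < 1 + x by rewrite ltr_pwDl.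
  rewrite geometric_sub_limit ?gt_eqF// normrN normrM normrX normrN (ger0_norm x0).
  rewrite mulrC ler_wpM2r ?exprn_ge0// gtr0_norm ?invr_gt0//.
  by rewrite invf_le1// lerDl.
have := cvg_derive_bound_pow dP dF le1.
rewrite addr0 ln1 subr0; apply: cvg_trans; apply: near_eq_cvg; near=> N.
rewrite big_mkord /P !fct_sumE -sumrB; apply: eq_bigr => i _ /=.
by rewrite /GRing.scale/= expr1n expr0n/= mul0r mulr0 subr0 mul1r.
Unshelve. all: by end_near. Qed.

Lemma atan_inv_sqrt3 : atan (Num.sqrt 3)^-1 = pi / 6 :> R.
Proof.
have pi0 : 0 < pi :> R := pi_gt0 R.
set t : R := pi / 6.
have s0 : 0 < sin t by apply: sin_gt0_pi; rewrite /t; apply/andP; split; lra.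
have c0 : 0 < cos t by apply: cos_gt0_pihalf; rewrite /t; apply/andP; split; lra.
have s_half : sin t = 2^-1.
  (* Since [2t = pi/2 - t], the double angle formula gives a quadratic equation for [sin t], whose
     root [-1] is excluded by positivity. *)
  have : cos (t *+ 2) = sin t.
    have -> : t *+ 2 = - (t - pi / 2) by rewrite /t mulr2n; field.
    by rewrite cosN cosBpihalf.
  rewrite cos_mulr2n cos2sin2 => e.
  have : (2 * sin t - 1) * (sin t + 1) = 0.
    have -> : (2 * sin t - 1) * (sin t + 1) = sin t - ((1 - sin t ^+ 2) *+ 2 - 1).
      by ring.
    by rewrite e subrr.
  move/eqP; rewrite mulf_eq0 => /orP[/eqP h|/eqP h]; last by lra.
  by lra.
have c_val : cos t = Num.sqrt 3 / 2.
  have c2 : cos t ^+ 2 = 3 / 4 by rewrite cos2sin2 s_half; field.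
  rewrite -[LHS]ger0_norm ?ltW// -sqrtr_sqr c2 sqrtrM//; congr (_ * _).
  rewrite (_ : 4^-1 = 2^-1 ^+ 2 :> R); last by field.
  by rewrite sqrtr_sqr ger0_norm.
have <- : tan t = (Num.sqrt 3)^-1.
  rewrite /tan s_half c_val; field.
  by rewrite sqrtr_eq0 -ltNge.
by rewrite tanK// in_itv/= /t; apply/andP; split; lra.
Qed.

(** Differentiating termwise gives [(1 + x) \sum (- x^3)^i], with limit
    [(1 + x)/(1 + x^3) = 1/(1 - x + x^2)]. A primitive of the latter is
    [2/sqrt 3 * atan ((2x - 1)/sqrt 3)]. *)
Lemma alternating_mod3_cvg :
  \sum_(0 <= i < N) (-1) ^+ i * ((i * 3).+1%:R^-1 + (i * 3).+2%:R^-1) @[N --> \oo]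
    --> (2 * pi / (3 * Num.sqrt 3) : R).
Proof.
set r3 : R := Num.sqrt 3.
have r30 : r3 != 0 by rewrite sqrtr_eq0 -ltNge.
have r32 : r3 * r3 = 3 by rewrite -expr2 sqr_sqrtr.
(* The minimum [3/4], reached at [x = 1/2], is the source of the constant [4/3] in [le1]. *)
have q_ge (x : R) : 3 / 4 <= 1 - x + x ^+ 2.
  have -> : 1 - x + x ^+ 2 = (x - 2^-1) ^+ 2 + 3 / 4 by field.
  by rewrite lerDr sqr_ge0.
have q_gt0 (x : R) : 0 < 1 - x + x ^+ 2 by rewrite (lt_le_trans _ (q_ge x)).
pose P (N : nat) : R -> R := \sum_(i < N) ((-1) ^+ i : R) \*:
  ((fun x : R => x ^+ (i * 3).+1 / (i * 3).+1%:R) +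
   (fun x : R => x ^+ (i * 3).+2 / (i * 3).+2%:R)).
pose P' (N : nat) (x : R) : R := (1 + x) * \sum_(i < N) (- x ^+ 3) ^+ i.
have dP N (x : R) : 0 <= x <= 1 -> is_derive x 1 (P N) (P' N x).
  move=> _; rewrite /P' mulr_sumr (eq_bigr (fun i : 'I_N =>
    (-1) ^+ i *: (x ^+ (i * 3) + x ^+ (i * 3).+1))).
    apply: is_derive_sum => i; apply/is_deriveZ.
    by apply: is_deriveD; exact: is_derive_monomial.
  by move=> i _; rewrite (exprNn (x ^+ 3)) -exprM mulnC exprS /GRing.scale/=; ring.
pose F : R -> R := (2 / r3) \*: (atan \o (fun x : R => (2 * x - 1) / r3)).
have dF (x : R) : 0 <= x <= 1 -> is_derive x 1 F (1 - x + x ^+ 2)^-1.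
  move=> _.
  have d1 := is_deriveZ r3^-1 (is_deriveB (is_deriveZ 2 (is_derive_id x (1 : R)))
    (is_derive_cst (1 : R) x (1 : R))).
  have := is_deriveZ (2 / r3) (is_derive1_comp (is_derive1_atan _) d1).
  congr is_derive.
    apply/funext => y; rewrite /F/= !fctE; congr (_ * atan _).
    exact: mulrC.
  change (2 / r3 * ((1 + (r3^-1 * (2 * x - 1)) ^+ 2)^-1 * (r3^-1 * (2 * 1 - 0)))
    = (1 - x + x ^+ 2)^-1).
  rewrite exprMn subr0 mulr1.
  have r3V : r3^-1 ^+ 2 = 3^-1 by rewrite exprVn expr2 r32.
  have -> : 1 + r3^-1 ^+ 2 * (2 * x - 1) ^+ 2 = 4 / 3 * (1 - x + x ^+ 2).
    by rewrite r3V; field.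
  have -> : 2 / r3 * ((4 / 3 * (1 - x + x ^+ 2))^-1 * (r3^-1 * 2)) =
    4 * r3^-1 ^+ 2 * (4 / 3)^-1 * (1 - x + x ^+ 2)^-1 by rewrite invfM; ring.
  by rewrite r3V; field; rewrite gt_eqF.
have le1 N (x : R) : 0 <= x <= 1 ->
    `|P' N x - (1 - x + x ^+ 2)^-1| <= 4 / 3 * x ^+ N.
  move=> /andP[x0 x1].
  have x13 : 1 + x ^+ 3 != 0 by rewrite gt_eqF// ltr_pwDl// exprn_ge0.
  have -> : P' N x - (1 - x + x ^+ 2)^-1 =
     (1 - x + x ^+ 2)^-1 * - (- x ^+ 3) ^+ N.
    rewrite /P'.
    have -> : (1 - x + x ^+ 2)^-1 = (1 + x) * (1 + x ^+ 3)^-1.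
      have -> : 1 + x ^+ 3 = (1 + x) * (1 - x + x ^+ 2) by ring.
      by rewrite invfM mulVKf// gt_eqF// ltr_pwDl.
    rewrite -mulrBr geometric_sub_limit//; ring.
  rewrite normrM normrN normrX normrN normrX (ger0_norm x0) -exprM.
  rewrite gtr0_norm ?invr_gt0// ler_pM ?invr_ge0 ?exprn_ge0 ?(ltW (q_gt0 x))//.
    by rewrite -[leRHS]invrK lef_pV2 ?posrE// invfM invrK mulrC.
  (* The actual error is of order [x^(3N)]; it is weakened to [x^N] because [x <= 1]. *)
  by rewrite ler_wiXn2l// leq_pmull.
have := cvg_derive_bound_pow dP dF le1.
(* The arguments of [atan] at the endpoints are [1/sqrt 3] and [-1/sqrt 3], so the difference is
   [2/sqrt 3 * 2 * pi/6]. *)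
have -> : F 1 - F 0 = 2 * pi / (3 * r3).
  rewrite /F !fctE /= mulr1 mulr0 sub0r mulN1r atanN.
  have -> : (2 - 1) / r3 = r3^-1 by field.
  by rewrite atan_inv_sqrt3 /GRing.scale/=; field.
apply: cvg_trans; apply: near_eq_cvg; near=> N.
rewrite big_mkord /P !fct_sumE -sumrB; apply: eq_bigr => i _ /=.
by rewrite !fctE /GRing.scale/= !expr1n !expr0n/= !mul0r addr0 mulr0 subr0 !mul1r.
Unshelve. all: by end_near. Qed.

(** The non-trivial Dirichlet character modulo 3. It records how the imaginary part of [u (x ^+ j)]
    depends on [j] when [x] has order 3 and [u] takes conjugate values at [x] and its inverse. *)
Definition chi3 (j : nat) : R := (j %% 3 == 1)%N%:R - (j %% 3 == 2)%N%:R.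

(** Blocks of three consecutive terms have odd length, so their leading signs alternate again. *)
Lemma alternating_sum_period3 (a : R ^nat) (N : nat) :
  (forall m j, a (m * 3 + j)%N = a j) ->
  \sum_(0 <= i < N * 3) (-1) ^+ i * a i.+1 / i.+1%:R =
  \sum_(0 <= i < N) (-1) ^+ i *
    (a 1 / (i * 3).+1%:R - a 2 / (i * 3).+2%:R + a 0 / (i * 3).+3%:R).
Proof.
move=> a_per; elim: N => [|N IHN]; first by rewrite !big_nil.
rewrite mulSnr addn3 !big_nat_recr//= IHN -!addrA; congr (_ + _).
have a1 : a (N * 3).+1 = a 1 by rewrite -addn1 a_per.
have a2 : a (N * 3).+2 = a 2 by rewrite -addn2 a_per.
(* The sum uses [a] from index 1 on; [a 0] merely represents the residue 0, which comes last in a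
   block. *)
have a0 : a (N * 3).+3 = a 0 by rewrite -addn3 -mulSnr -[(_ * 3)%N]addn0 a_per.
rewrite a1 a2 a0 !exprS mulnC exprM -[(-1) ^+ 3]signr_odd/= expr1; ring.
Qed.

Lemma cvg_mul_index (u : R ^nat) (l : R) (k : nat) : (0 < k)%N ->
  u n @[n --> \oo] --> l -> u (n * k)%N @[n --> \oo] --> l.
Proof.
move=> k0; apply: cvg_comp => A [N _ NA]; exists N => //= n /= Nn.
by apply: NA; rewrite /= (leq_trans Nn)// leq_pmulr.
Qed.

Lemma sum_wedge_coef_cst (k : nat) : odd k ->
  \sum_(1 <= j < k.+1) wedge_coef R k j = ln 2.
Proof.
move=> k_odd; under eq_bigr do rewrite -[wedge_coef _ _ _]mulr1.
apply: (@sum_wedge_coef _ _ (fun=> 1)) => //.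
under eq_fun do under eq_bigr do rewrite mulr1.
apply: (cvg_mul_index _ alternating_harmonic_cvg).
by case: k k_odd.
Qed.

(** As 3 divides [k], a sequence of period 3 also has period [k], and partial sums of length [M * k]
    form a subsequence of the sums of blocks of three. *)
Lemma sum_wedge_coef_period3 (k : nat) (a : R ^nat) (l : R) : odd k -> (3 %| k)%N ->
  (forall m j, a (m * 3 + j)%N = a j) ->
  \sum_(0 <= i < N) (-1) ^+ i * (a 1 / (i * 3).+1%:R - a 2 / (i * 3).+2%:R +
     a 0 / (i * 3).+3%:R) @[N --> \oo] --> l ->
  \sum_(1 <= j < k.+1) wedge_coef R k j * a j = l.
Proof.
move=> k_odd /dvdnP[q kE] a_per a_l; apply: sum_wedge_coef => //.
  by move=> m j; rewrite kE mulnA a_per.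
rewrite kE; under eq_fun do rewrite mulnA alternating_sum_period3//.
apply: cvg_mul_index a_l.
by case: q kE k_odd => [->|].
Qed.

(** Only the last term of each block survives, leaving the alternating harmonic series divided by
    3. *)
Lemma sum_wedge_coef_dvd3 (k : nat) : odd k -> (3 %| k)%N ->
  \sum_(1 <= j < k.+1) wedge_coef R k j * (3 %| j)%N%:R = ln 2 / 3.
Proof.
move=> k_odd k3; apply: (@sum_wedge_coef_period3 k (fun j => (3 %| j)%N%:R)) => //=.
  by move=> m j; rewrite dvdn_addr ?dvdn_mull.
have : (\sum_(0 <= i < N) (-1) ^+ i / i.+1%:R) / 3 @[N --> \oo] --> (ln 2 / 3 : R).
  by apply: cvgMl; exact: alternating_harmonic_cvg.
apply: cvg_trans; apply: near_eq_cvg; near=> N.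
rewrite mulr_suml; apply: eq_bigr => i _.
rewrite !mul0r subr0 add0r mul1r -(addn3 (i * 3)) -mulSnr natrM invfM; ring.
Unshelve. all: by end_near. Qed.

Lemma sum_wedge_coef_chi3 (k : nat) : odd k -> (3 %| k)%N ->
  \sum_(1 <= j < k.+1) wedge_coef R k j * chi3 j = 2 * pi / (3 * Num.sqrt 3).
Proof.
move=> k_odd k3; apply: sum_wedge_coef_period3 => //.
  by move=> m j; rewrite /chi3 modnMDl.
rewrite /chi3/=; have := alternating_mod3_cvg; apply: cvg_trans.
apply: near_eq_cvg; near=> N; apply: eq_bigr => i _.
by rewrite subr0 sub0r subrr !mul0r mulN1r addr0 mul1r opprK.
Unshelve. all: by end_near. Qed.

End SpecialSums.

(** * Class sizes and inversion in finite groups *)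

Section OrderTwentyOne.
Context {gT : finGroupType}.
Local Notation G := [set: gT]%SET.

(* A central element of order [p] would have a quotient of prime order [q],
   so [G] would be cyclic modulo a central subgroup, hence abelian. *)
Lemma card_class_pq (p q : nat) (x : gT) : prime q -> #|G| = (p * q)%N ->
  ~~ abelian G -> #[x]%g = p -> #|(x ^: G)%g| = q.
Proof.
move=> q_pr cardG nabG ox.
have p0 : (0 < p)%N by rewrite -ox order_gt0.
have x_cent : <[x]>%g \subset 'C_G[x]%g by rewrite cycle_subG inE cent1id inE.
have := Lagrange (subsetIl G 'C[x])%g; rewrite index_cent1 cardG.
(* The centralizer contains the cyclic group of [x], so [p] divides its order and the class size,
   its index, divides [q]. *)
have /dvdnP[e ->] : (p %| #|'C_G[x]%g|)%N by rewrite -ox orderE cardSg.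
rewrite (mulnC e) -mulnA => /eqP; rewrite eqn_pmul2l// => /eqP eq_q.
have : (#|(x ^: G)%g| %| q)%N by rewrite -eq_q dvdn_mull.
have /primeP[_ q_div] := q_pr.
move=> /q_div /orP[/eqP class1|/eqP//].
have xC y : commute x y.
  apply/commgP/conjg_fixP.
  have /card1P[z Hz] : #|(x ^: G)%g| == 1 by apply/eqP.
  have := Hz (x ^ y)%g; have := Hz x.
  by rewrite class_refl memJ_class ?inE// => /esym/eqP-> /esym/eqP.
have xZ : <[x]>%g \subset 'Z(G)%g.
  by rewrite cycle_subG; apply/centerP; split=> [|y _]; rewrite ?inE.
case/negP: nabG; apply: (@cyclic_factor_abelian _ <[x]>%G) => //.
have sub_norm : G \subset 'N(<[x]>)%g.
  by apply: cents_norm; rewrite centsC (fintype.subset_trans xZ) ?subsetIr.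
apply: prime_cyclic; rewrite card_quotient//.
by rewrite -divgS ?subsetT//= cardG -orderE ox mulKn.
Qed.

(** If [y] inverts [x], then [y ^+ 2] commutes with [x]. In odd order [y] is a power of [y ^+ 2], so
    [y] commutes with [x] too; then [x] equals its inverse and its order divides 2 and [#|G|]. *)
Lemma odd_conj_inv (x : gT) : odd #|G| -> (x^-1 \in x ^: G)%g -> x = 1%g.
Proof.
move=> oddG /imsetP[y _ xy].
have y2 : commute x (y ^+ 2)%g.
  by apply/commgP/conjg_fixP; rewrite expgS expg1 conjgM -xy conjVg -xy invgK.
have xyC : commute x y.
  have -> : y = ((y ^+ 2) ^+ (#|G|./2).+1)%g.
    rewrite -expgM.
    have -> : (2 * (#|G|./2).+1 = #|G|.+1)%N.
      by rewrite mul2n doubleS -[in RHS](odd_double_half #|G|) oddG.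
    by rewrite expgS expg_cardG ?inE// mulg1.
  exact: commuteX.
have xV : x = x^-1%g by rewrite xy; apply/esym/conjg_fixP/commgP.
have : (#[x]%g %| gcdn 2 #|G|)%N.
  rewrite dvdn_gcd order_dvdG ?inE// andbT order_dvdn expgS expg1 {2}xV.
  by rewrite mulgV.
have /eqP-> : coprime 2 #|G| by rewrite coprime2n.
by rewrite dvdn1 order_eq1 => /eqP.
Qed.

End OrderTwentyOne.

(** * The five conjugacy classes and their behaviour under powers *)

Section ClassNumbering.
Context {gT : finGroupType}.
Local Notation G := [set: gT]%SET.
Hypotheses (cardG : #|G| = 21%N) (nabG : ~~ abelian G).
Variable cl : class_numbering gT.

Lemma class_of_orderE n (C : {set gT}) (x : gT) :
  is_class_of_order n C -> x \in C -> C = (x ^: G)%g.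
Proof.
by move=> [/imsetP[y _ ->] _] xC; apply/esym/class_eqP.
Qed.

Lemma class_of_order_repr n (C : {set gT}) : is_class_of_order n C -> repr C \in C.
Proof. by move=> [CG _]; exact: mem_repr_classes CG. Qed.

Lemma class_of_orderJ n (C : {set gT}) (x y : gT) :
  is_class_of_order n C -> (x ^ y \in C)%g = (x \in C).
Proof.
move=> [/imsetP[z _ ->] _].
by apply/class_eqP/class_eqP; rewrite classGidl ?inE.
Qed.

Lemma class_of_order_setI n1 n2 (C D : {set gT}) : C <> D ->
  is_class_of_order n1 C -> is_class_of_order n2 D -> C :&: D = finset.set0.
Proof.
move=> CD hC hD; apply/setP => x; rewrite !inE.
apply/negP => /andP[xC xD]; apply: CD.
by rewrite (class_of_orderE hC xC) (class_of_orderE hD xD).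
Qed.

Lemma card_class_of_order (p q : nat) (C : {set gT}) : prime q -> (p * q)%N = 21%N ->
  is_class_of_order p C -> #|C| = q.
Proof.
move=> q_pr pq hC; have xC := class_of_order_repr hC.
rewrite (class_of_orderE hC xC); apply: (card_class_pq q_pr _ nabG (hC.2 _ xC)).
by rewrite cardG.
Qed.

Variant class_spec (x : gT) : Prop :=
  | InOne of x = 1%g
  | InC7A of x \in C7A cl
  | InC7B of x \in C7B cl
  | InC3A of x \in C3A cl
  | InC3B of x \in C3B cl.

(* The five classes are disjoint and 1 + 3 + 3 + 7 + 7 = 21. *)
Lemma class_numberingP (x : gT) : class_spec x.
Proof.
have [[[hA hB] kA] kB] := (C7A_order cl, C7B_order cl, C3A_order cl, C3B_order cl).
have c7 := @card_class_of_order 7 3 _ isT erefl.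
have c3 := @card_class_of_order 3 7 _ isT erefl.
(* Classes of different element orders are distinct; the record itself only separates 7A from 7B and
   3A from 3B. *)
have neq n m (C D : {set gT}) : is_class_of_order n C -> is_class_of_order m D ->
    n != m -> C <> D.
  move=> hC hD nm CD; have xC := class_of_order_repr hC.
  by case/eqP: nm; rewrite -(hC.2 _ xC) -(hD.2 (repr C))// -CD.
have one n (C : {set gT}) : is_class_of_order n C -> n != 1 -> 1%g \notin C.
  by move=> hC; apply: contraNN => /hC.2; rewrite order1 => <-.
pose U := 1%g |: (C7A cl :|: C7B cl :|: (C3A cl :|: C3B cl)).
have cardU : #|U| = 21%N.
  rewrite cardsU1 !inE (negbTE (one _ _ hA isT)) (negbTE (one _ _ hB isT)).
  rewrite (negbTE (one _ _ kA isT)) (negbTE (one _ _ kB isT)) /= !cardsU.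
  rewrite finset.setIUl !finset.setIUr.
  rewrite (class_of_order_setI (@C7A_neq_C7B _ cl) hA hB).
  rewrite (class_of_order_setI (@C3A_neq_C3B _ cl) kA kB).
  rewrite (class_of_order_setI (neq _ _ _ _ hA kA isT) hA kA).
  rewrite (class_of_order_setI (neq _ _ _ _ hA kB isT) hA kB).
  rewrite (class_of_order_setI (neq _ _ _ _ hB kA isT) hB kA).
  rewrite (class_of_order_setI (neq _ _ _ _ hB kB isT) hB kB).
  by rewrite !finset.setU0 !cards0 (c7 _ hA) (c7 _ hB) (c3 _ kA) (c3 _ kB).
have UG : U = G by apply/eqP; rewrite eqEcard finset.subsetT cardU cardG.
have : x \in U by rewrite UG inE.
rewrite !inE -!orbA => /or4P[/eqP||| /orP[]].
- exact: InOne.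
- exact: InC7A.
- exact: InC7B.
- exact: InC3A.
- exact: InC3B.
Qed.

Lemma mem_C3 (x : gT) : #[x]%g = 3%N -> x \in C3A cl \/ x \in C3B cl.
Proof.
have [hA hB] := (C7A_order cl, C7B_order cl).
move=> ox; case: (class_numberingP x) ox => [->|/hA.2->|/hB.2->|xA|xB] //.
- by rewrite order1.
- by left.
- by right.
Qed.

(** The inverse still has order 3, and it cannot lie in the class of [x] because the group has odd
    order. *)
Lemma C3A_inv (x : gT) : x \in C3A cl -> (x^-1)%g \in C3B cl.
Proof.
move=> xA; have ox := (C3A_order cl).2 _ xA.
have [] // := mem_C3 (x := (x^-1)%g); first by rewrite orderV.
rewrite (class_of_orderE (C3A_order cl) xA) => /odd_conj_inv x1.
by move: ox; rewrite x1 ?cardG// order1.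
Qed.

Lemma C3B_inv (x : gT) : x \in C3B cl -> (x^-1)%g \in C3A cl.
Proof.
move=> xB; have ox := (C3B_order cl).2 _ xB.
have [] // := mem_C3 (x := (x^-1)%g); first by rewrite orderV.
rewrite (class_of_orderE (C3B_order cl) xB) => /odd_conj_inv x1.
by move: ox; rewrite x1 ?cardG// order1.
Qed.

Lemma C7_expg (x : gT) (j : nat) : #[x]%g = 7%N ->
  [\/ (x ^+ j)%g = 1%g, (x ^+ j)%g \in C7A cl | (x ^+ j)%g \in C7B cl].
Proof.
move=> ox; have := orderXdvd x j; rewrite ox.
have [kA kB] := (C3A_order cl, C3B_order cl).
case: (class_numberingP (x ^+ j)%g) => [||| /kA.2->|/kB.2->] // h _.
- exact: Or31.
- exact: Or32.
- exact: Or33.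
Qed.

End ClassNumbering.

(** * The wedge operation at elements of the various orders *)

Section Wedge.
Context {R : realType} {gT : finGroupType}.
Local Notation G := [set: gT]%SET.
Implicit Types (u : gT -> R[i]) (x : gT).

Lemma powR2E (a : R) : 2 `^ a = expR (a * ln 2).
Proof. by rewrite /powR pnatr_eq0. Qed.

Lemma sum_complexE (s : seq nat) (c a b : nat -> R) :
  \sum_(j <- s) (c j)%:C%C * (a j +i* b j)%C =
  ((\sum_(j <- s) c j * a j) +i* (\sum_(j <- s) c j * b j))%C.
Proof.
elim: s => [|j s IHs]; first by rewrite !big_nil.
by rewrite !big_cons IHs /real_complex_def; simpc.
Qed.

Lemma class_valE u n (C : {set gT}) x : is_class_fun u ->
  is_class_of_order n C -> x \in C -> u x = class_val u C.
Proof.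
move=> hu hC xC; rewrite /class_val.
have : repr C \in (x ^: G)%g.
  by rewrite -(class_of_orderE hC xC) (class_of_order_repr hC).
by move=> /imsetP[y _ ->]; rewrite hu.
Qed.

Lemma wedge_sub1_class_fun u : is_class_fun u -> is_class_fun (wedge_sub1 u).
Proof.
move=> hu x y; rewrite /wedge_sub1 /wedge; congr (cexp _ - _).
by apply: eq_bigr => j _; rewrite -conjXg hu.
Qed.

(** The exponent is the sum of all coefficients, [ln 2], so the value is [2 - 1]. *)
Lemma wedge_sub1_eq1 u x : odd #|G| -> (forall j, u (x ^+ j)%g = 1) ->
  wedge_sub1 u x = 1.
Proof.
move=> oddG u1; rewrite /wedge_sub1 /wedge.
rewrite (eq_bigr (fun j => (wedge_coef R #|G| j)%:C%C * (1 +i* 0)%C)); last first.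
  by move=> j _; rewrite u1.
rewrite sum_complexE /=; under eq_bigr do rewrite mulr1.
rewrite sum_wedge_coef_cst//; under eq_bigr do rewrite mulr0.
rewrite big1_eq cos0 sin0 mulr0 mulr1 lnK ?posrE//.
by apply/eqP; rewrite eq_complex /= subr0 eqxx andbT; apply/eqP; ring.
Qed.

Lemma wedge_sub1_order3 u x (a b : R) : odd #|G| -> #[x]%g = 3%N ->
  u 1%g = 1 -> u x = (a +i* b)%C -> u (x^-1)%g = (a -i* b)%C ->
  wedge_sub1 u x = ((Phi (a, b)).1 +i* (Phi (a, b)).2)%C.
Proof.
move=> oddG ox u1 ux uV.
have dvd3 : (3 %| #|G|)%N by rewrite -ox order_dvdG ?inE.
(* The values [1], [a + ib], [a - ib] at residues 0, 1, 2 are interpolated by the constant 1, the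
   indicator of [3 %| j] and [chi3], whose weighted sums are known. *)
have uX j : u (x ^+ j)%g = ((a + (1 - a) * (3 %| j)%N%:R) +i* (b * chi3 j))%C.
  have xV : (x^-1 = x ^+ 2)%g by rewrite invg_expg ox.
  rewrite -expg_mod_order ox /chi3 /dvdn.
  have : (j %% 3 < 3)%N by rewrite ltn_mod.
  case: (j %% 3)%N => [|[|[|//]]] _ /=; rewrite ?expg0 ?expg1 -?xV ?u1 ?ux ?uV;
    by congr (_ +i* _)%C; ring.
rewrite /wedge_sub1 /wedge; under eq_bigr do rewrite uX.
rewrite sum_complexE.
(* The real part is [a ln 2 + (1 - a) (ln 2)/3]. *)
have -> : \sum_(1 <= j < #|G|.+1)
    wedge_coef R #|G| j * (a + (1 - a) * (3 %| j)%N%:R) =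
    3^-1 * (2 * a + 1) * ln 2.
  under eq_bigr do rewrite mulrDr mulrCA [_ * a]mulrC.
  rewrite big_split/= -!mulr_sumr sum_wedge_coef_cst// sum_wedge_coef_dvd3//.
  by field.
have -> : \sum_(1 <= j < #|G|.+1) wedge_coef R #|G| j * (b * chi3 j) =
    2 * pi * b / (3 * Num.sqrt 3).
  under eq_bigr do rewrite mulrCA.
  by rewrite -mulr_sumr sum_wedge_coef_chi3//; ring.
rewrite /= -powR2E; apply/eqP.
by rewrite eq_complex /= subr0 !eqxx.
Qed.

End Wedge.

(** * Stability, coordinates and the formula for the transformation *)

Theorem lemma6p2 (R : realType) (G : finGroupType) (hG : is_C7_sdprod_C3 G)
    (cl : class_numbering G) :
  [/\ forall u : G -> R[i], one_off_3 cl u -> one_off_3 cl (wedge_sub1 u),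
      forall u : G -> R[i], one_off_3 cl u -> conj_on_3 cl u ->
        conj_on_3 cl (wedge_sub1 u),
      set_bij (one_off_3 (R := R) cl `&` conj_on_3 cl)%classic
        [set: (R * R)%type]%classic (coord_3A (R := R) cl)
    & forall u : G -> R[i], one_off_3 cl u -> conj_on_3 cl u ->
        coord_3A cl (wedge_sub1 u) = Phi (coord_3A cl u)].
Proof.
have [cardG nabG] : #|[set: G]%SET| = 21%N /\ ~~ abelian [set: G]%SET.
  case: hG => K [H [KH [_ K7] [_ H3] nab]]; split=> //.
  by rewrite -(sdprod_card KH) K7 H3.
have [[[hA hB] kA] kB] := (C7A_order cl, C7B_order cl, C3A_order cl, C3B_order cl).
have oddG : odd #|[set: G]%SET| by rewrite cardG.
(* Every power of an element of order 7 is trivial or again of order 7, where [u] is 1. *)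
have u7 (u : G -> R[i]) x : one_off_3 cl u -> #[x]%g = 7%N ->
    wedge_sub1 u x = 1 :> R[i].
  move=> [hu [u1 uA uB]] ox; apply: wedge_sub1_eq1 => // j.
  case: (C7_expg cardG nabG cl j ox) => [->|xA|xB].
  - by rewrite -u1 /class_val repr_set1.
  - by rewrite (class_valE hu hA xA).
  - by rewrite (class_valE hu hB xB).
have [rA rB] := (class_of_order_repr kA, class_of_order_repr kB).
have rAV := C3A_inv cardG nabG rA; have rBV := C3B_inv cardG nabG rB.
(* Both values are computed together: the pair gives invariance of the conjugation condition, and
   the value on 3A gives the formula in coordinates. *)
have w3 (u : G -> R[i]) : one_off_3 cl u -> conj_on_3 cl u ->
    let p := Phi (coord_3A cl u) in
    class_val (wedge_sub1 u) (C3A cl) = (p.1 +i* p.2)%C :> R[i] /\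
    class_val (wedge_sub1 u) (C3B cl) = (p.1 -i* p.2)%C :> R[i].
  move=> [hu [u1 _ _]] huc /=.
  rewrite /class_val repr_set1 in u1.
  have uA := class_valE hu kA rA; have uAV := class_valE hu kB rAV.
  have uB := class_valE hu kB rB; have uBV := class_valE hu kA rBV.
  move: huc; rewrite /conj_on_3 /= => huc; rewrite -huc in uAV uB.
  rewrite /coord_3A; case: (class_val u (C3A cl)) uA uAV uB uBV => a b /=.
  move=> uA uAV uB uBV; split.
    exact: wedge_sub1_order3 oddG (kA.2 _ rA) u1 uA uAV.
  (* On 3B the same computation is made with [-b] in place of [b]; cosine is even and sine is odd,
     so the result is the conjugate. *)
  rewrite /class_val (wedge_sub1_order3 oddG (kB.2 _ rB) u1 uB) ?uBV ?opprK//=.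
  by rewrite mulrN mulNr cosN sinN mulrN.
split.
- move=> u hu; split; first exact: wedge_sub1_class_fun hu.1.
  split; rewrite /class_val.
  + rewrite repr_set1; apply: wedge_sub1_eq1 => // j.
    by rewrite expg1n; have [_ [+ _ _]] := hu; rewrite /class_val repr_set1.
  + by apply: u7 => //; apply/hA.2/(class_of_order_repr hA).
  + by apply: u7 => //; apply/hB.2/(class_of_order_repr hB).
- move=> u hu huc; have [wA wB] := w3 u hu huc.
  by rewrite /conj_on_3/= wA wB.
- split=> //.
  (* Injectivity: the value on 3A determines the one on 3B by conjugation, the other three values
     are fixed, and the five classes cover the group. *)
  + move=> u v /set_mem[[hu [u1 uA uB]] huc] /set_mem[[hv [v1 vA vB]] hvc].
    rewrite /coord_3A => -[eRe eIm].
    have eA : class_val u (C3A cl) = class_val v (C3A cl).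
      by apply/eqP; rewrite eq_complex eRe eIm !eqxx.
    have eB : class_val u (C3B cl) = class_val v (C3B cl) by rewrite -huc -hvc eA.
    apply/funext => x; case: (class_numberingP cardG nabG cl x) => [->|xC|xC|xC|xC].
    * by move: u1 v1; rewrite /class_val repr_set1 => -> ->.
    * by rewrite !(class_valE _ hA xC)// uA vA.
    * by rewrite !(class_valE _ hB xC)// uB vB.
    * by rewrite !(class_valE _ kA xC).
    * by rewrite !(class_valE _ kB xC).
  + move=> [a b] _.
    (* Surjectivity: the preimage of [(a, b)] takes conjugate values on 3A and 3B and is 1
       elsewhere. *)
    pose u (x : G) : R[i] := if x \in C3A cl then (a +i* b)%C else
                   if x \in C3B cl then (a -i* b)%C else 1.
    have u1 x : #[x]%g != 3%N -> u x = 1.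
      rewrite /u => ox; case: ifPn => [/kA.2 e|_]; first by rewrite e in ox.
      by case: ifPn => // /kB.2 e; rewrite e in ox.
    exists u; last first.
      by rewrite /coord_3A /class_val /u rA.
    have vB : class_val u (C3B cl) = (a -i* b)%C.
      rewrite /class_val /u rB ifN//; apply/negP => rBA.
      have : repr (C3B cl) \in C3A cl :&: C3B cl by rewrite inE rBA.
      by rewrite (class_of_order_setI (@C3A_neq_C3B _ cl) kA kB) inE.
    split; last by rewrite /conj_on_3/= vB /class_val /u rA.
    split.
      by move=> x y; rewrite /u !(class_of_orderJ _ _ kA) !(class_of_orderJ _ _ kB).
    split; apply: u1; first by rewrite repr_set1 order1.
      by rewrite (hA.2 _ (class_of_order_repr hA)).
    by rewrite (hB.2 _ (class_of_order_repr hB)).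
- move=> u hu huc; have [wA _] := w3 u hu huc.
  by rewrite {1}/coord_3A wA; case: (Phi _).
Qed.
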